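(* Consider a fully connected gossip network with a source and $n$ end-nodes as described in the context, and let $\rho=\lambda_e/\lambda$. Let $F^{(n)}=\lim_{t\to\infty}\mathbb{E}[F_1(t)]$ denote the average binary freshness of a single end-node. Then, as $n\to\infty$, $F^{(n)}$ decreases to $0$ as $n^{-\rho}$ when $0<\rho<1$; as $\frac{\log n}{n}$ when $\rho=1$; and as $n^{-1}$ when $\rho>1$ (in each case, $F^{(n)}$ is bounded above and below by positive constant multiples of the stated function for all sufficiently large $n$).
   Context: Model: The information at the source is updated (a new version is generated) according to a Poisson process of rate $\lambda_e>0$. The source sends its current version to each end-node $j\in\{1,\dots,n\}$ according to a Poisson process of rate $\lambda/n$, where $\lambda>0$. The end-nodes are fully connected: each end-node $i$ sends its stored version to each other end-node $j\ne i$ according to a Poisson process of rate $\lambda/(n-1)$. All processes are independent. A node receiving a version keeps the fresher of its stored and received versions. The binary freshness $F_j(t)$ of node $j$ is $1$ if node $j$ stores the current source version at time $t$ and $0$ otherwise; thus it becomes $0$ whenever the source generates a new version, becomes $1$ when the source updates node $j$, and becomes $\max(F_i,F_j)$ when node $i$ updates node $j$. *)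

(* Defs.v *)
From HB Require Import structures.
From mathcomp Require Import all_boot all_order all_algebra.
From mathcomp Require Import all_classical all_reals all_analysis.
Set Implicit Arguments. Unset Strict Implicit. Unset Printing Implicit Defensive.
Import Order.TTheory GRing.Theory Num.Theory numFieldTopology.Exports numFieldNormedType.Exports.
Local Open Scope ring_scope.

(* The binary-freshness process of the n end-nodes is a continuous-time
   Markov chain on the finite state space of freshness vectors
   x : 'I_n -> bool  (x j = F_j). *)
Definition fstate (n : nat) := {ffun 'I_n -> bool}.

Definition ev_gen (n : nat) : fstate n := [ffun => false].
Definition ev_src (n : nat) (j : 'I_n) (x : fstate n) : fstate n :=
  [ffun k => if k == j then true else x k].
Definition ev_gossip (n : nat) (i j : 'I_n) (x : fstate n) : fstate n :=
  [ffun k => if k == j then x i || x j else x k].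

Section Gen.
Variable R : realType.

(* total rate of jumping from x to y (events with no effect included; they
   are discarded on the diagonal) *)
Definition frate (lam_e lam : R) (n : nat) (x y : fstate n) : R :=
  lam_e * (ev_gen n == y)%:R
  + \sum_(j : 'I_n) (lam / n%:R) * (ev_src j x == y)%:R
  + \sum_(i : 'I_n) \sum_(j : 'I_n | j != i)
        (lam / (n.-1)%:R) * (ev_gossip i j x == y)%:R.

Definition fgen (lam_e lam : R) (n : nat) (x y : fstate n) : R :=
  if x == y then - \sum_(z : fstate n | z != x) frate lam_e lam x z
  else frate lam_e lam x y.

Fixpoint fgen_pow (lam_e lam : R) (n : nat) (k : nat) (x y : fstate n) : R :=
  match k with
  | 0 => (x == y)%:R
  | k'.+1 => \sum_(z : fstate n) fgen_pow lam_e lam k' x z * fgen lam_e lam z y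
  end.

Definition ftrans (lam_e lam : R) (n : nat) (t : R) (x y : fstate n) : R :=
  limn (series (fun k : nat => t ^+ k / (k`!)%:R * fgen_pow lam_e lam k x y)).

(* F_1: freshness of end-node 1 (the node with index 0 in 'I_n) *)
Definition fresh1 (n : nat) (x : fstate n) : bool :=
  [exists i : 'I_n, (nat_of_ord i == 0%N) && x i].

Definition mean_fresh1 (lam_e lam : R) (n : nat) (p0 : fstate n -> R) (t : R) : R :=
  \sum_(x : fstate n) \sum_(y : fstate n)
     p0 x * ftrans lam_e lam t x y * (fresh1 y)%:R.

Definition is_distr (n : nat) (p0 : fstate n -> R) : Prop :=
  (forall x, 0 <= p0 x) /\ \sum_(x : fstate n) p0 x = 1.

Definition theta_eventually (F g : nat -> R) : Prop :=
  exists c1 c2 : R, 0 < c1 /\ 0 < c2 /\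
    exists N : nat, forall n : nat, (N <= n)%N ->
      c1 * g n <= F n /\ F n <= c2 * g n.

End Gen.

(* Main.v *)
Require Import Defs.
From HB Require Import structures.
From mathcomp Require Import all_boot all_order all_algebra.
From mathcomp Require Import all_classical all_reals all_analysis.
From mathcomp Require Import ring lra zify.
Set Implicit Arguments. Unset Strict Implicit. Unset Printing Implicit Defensive.
Import Order.TTheory GRing.Theory Num.Theory numFieldTopology.Exports numFieldNormedType.Exports.
Local Open Scope classical_set_scope.
Local Open Scope ring_scope.

(** Let [f_S] be the indicator that some node of the set [S] is fresh. The generator
    maps [f_S] to a combination of [1], [f_S] and the [f_(S + i)], [i] outside [S],
    so the means [E f_S] solve a triangular linear system of differential equations.
    Its equilibrium depends only on [j = #|S|]; with [rho = lam_e / lam] and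
    [c_j = j (n - j) / (n - 1)] it is given by
      [(rho + j / n + c_j) phi_j = j / n + c_j phi_(j+1)].
    Each row of the system has diagonal dominance at least [lam_e], hence
    [E f_S - phi_#|S|] is [O(exp (- lam_e t))], by induction from the full set down,
    and the limiting freshness of one node is [phi_1]. Its order of magnitude follows by
    comparing [phi] with explicit super- and subsolutions of the recurrence, which
    behave like [(j/n)^rho] and [j/n] (with a factor [ln (n/j)] when [rho = 1]). *)

(** * Gossip rate into a set of nodes *)

Section PullRate.
Variable R : realType.

(** In units of [lam]: [j (n - j)] ordered pairs lead from outside a set of size [j] into it, each
    at rate [1 / (n - 1)]. *)
Definition pull_rate (n j : nat) : R := j%:R * (n - j)%:R / n.-1%:R.

Lemma pull_rate_ge0 n j : 0 <= pull_rate n j.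
Proof. by rewrite divr_ge0 ?mulr_ge0. Qed.

Lemma pull_rate_nn n : pull_rate n n = 0.
Proof. by rewrite /pull_rate subnn mulr0 mul0r. Qed.

Lemma pull_rate_le n j : (0 < j <= n)%N -> pull_rate n j <= j%:R.
Proof.
move=> /andP[j0 jn]; rewrite /pull_rate -mulrA ler_piMr//.
have [n1|n1] := leqP n 1; first by have -> : (n - j = 0)%N by lia; rewrite mul0r.
rewrite ler_pdivrMr ?mul1r ?ler_nat ?ltr0n; lia.
Qed.

(** The gap below the upper bound [j] is [j (j - 1) / (n - 1)]; the subsolutions have to absorb
    it. *)
Lemma pull_rateE n j : (1 < n)%N -> (j <= n)%N ->
  pull_rate n j = j%:R - j%:R * (j%:R - 1) / (n%:R - 1).
Proof.
move=> n1 jn; have N1 : 1 < n%:R :> R by rewrite ltr1n.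
rewrite /pull_rate natrB// -subn1 natrB 1?ltnW//.
by field; lra.
Qed.
End PullRate.
Arguments pull_rate {R} n j.

(** * The equilibrium recurrence and its comparison principle *)

Section Recurrence.
Variables (R : realType) (rho : R).
Hypothesis rho_gt0 : 0 < rho.

(* Recursion on [m = n - j]: the recurrence runs down from the full set [j = n]. *)
Fixpoint set_fresh_rev (n m : nat) : R :=
  ((n - m)%:R / n%:R +
   pull_rate n (n - m) * (if m is m'.+1 then set_fresh_rev n m' else 0)) /
  (rho + (n - m)%:R / n%:R + pull_rate n (n - m)).

Definition set_fresh (n j : nat) : R := set_fresh_rev n (n - j).

Lemma total_rate_gt0 n j : 0 < rho + j%:R / n%:R + pull_rate n j.
Proof.
have : 0 <= j%:R / n%:R :> R by rewrite divr_ge0.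
by have := pull_rate_ge0 R n j; have := rho_gt0; lra.
Qed.

Lemma set_freshE n j : (j <= n)%N ->
  (rho + j%:R / n%:R + pull_rate n j) * set_fresh n j =
  j%:R / n%:R + pull_rate n j * set_fresh n j.+1.
Proof.
move=> jn; rewrite /set_fresh.
have b0 := lt0r_neq0 (total_rate_gt0 n j).
move: jn; rewrite leq_eqVlt => /orP[/eqP ejn|jn].
  (* By truncated subtraction [set_fresh n n.+1] is a default value, equal to [set_fresh n n]; the
     vanishing pull rate removes it. *)
  by subst j; rewrite subnn /= subn0 mulrC divfK// pull_rate_nn !mul0r.
by rewrite -(subnSK jn) /= subnSK// subKn 1?ltnW// mulrC divfK.
Qed.

(** Comparison propagates downward from [j = n], because [psi j.+1] carries the nonnegative weight
    [pull_rate n j]; this weight is zero at [j = n], which starts the induction. *)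
Lemma set_fresh_le_supersolution n (psi : nat -> R) :
  (forall j, (0 < j <= n)%N -> j%:R / n%:R + pull_rate n j * psi j.+1 <=
     (rho + j%:R / n%:R + pull_rate n j) * psi j) ->
  forall j, (0 < j <= n)%N -> set_fresh n j <= psi j.
Proof.
move=> Hpsi j; elim: {j}(n - j)%N {-2}j (erefl (n - j)%N) => [|m IH] j mE jn.
  have ej : j = n by lia.
  rewrite -(ler_pM2l (total_rate_gt0 n j)); apply: le_trans (Hpsi j jn).
  by rewrite set_freshE ?ej// pull_rate_nn !mul0r.
rewrite -(ler_pM2l (total_rate_gt0 n j)); apply: le_trans (Hpsi j jn).
rewrite set_freshE; last lia.
by rewrite lerD2l ler_wpM2l ?pull_rate_ge0 ?IH; lia.
Qed.

Lemma set_fresh_ge_subsolution n (psi : nat -> R) :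
  (forall j, (0 < j <= n)%N -> (rho + j%:R / n%:R + pull_rate n j) * psi j <=
     j%:R / n%:R + pull_rate n j * psi j.+1) ->
  forall j, (0 < j <= n)%N -> psi j <= set_fresh n j.
Proof.
move=> Hpsi j; elim: {j}(n - j)%N {-2}j (erefl (n - j)%N) => [|m IH] j mE jn.
  have ej : j = n by lia.
  rewrite -(ler_pM2l (total_rate_gt0 n j)); apply: le_trans (Hpsi j jn) _.
  by rewrite set_freshE ?ej// pull_rate_nn !mul0r.
rewrite -(ler_pM2l (total_rate_gt0 n j)); apply: le_trans (Hpsi j jn) _.
rewrite set_freshE; last lia.
by rewrite lerD2l ler_wpM2l ?pull_rate_ge0 ?IH; lia.
Qed.

Lemma set_fresh_ge0 n j : (0 < j <= n)%N -> 0 <= set_fresh n j.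
Proof.
apply: (@set_fresh_ge_subsolution n (fun=> 0)) => i _.
by rewrite !mulr0 addr0 divr_ge0.
Qed.

(* For a monotone [psi] the pull rate [j (n - j) / (n - 1)] may be replaced by its
   upper bound [j], which makes the recurrence solvable in closed form. *)
Lemma set_fresh_le_monotone n (psi : nat -> R) : (0 < n)%N ->
  (forall j, (0 < j <= n)%N -> 0 <= psi j) ->
  (forall j, (0 < j < n)%N -> psi j <= psi j.+1) ->
  (forall j, (0 < j < n)%N -> j%:R / n%:R + j%:R * psi j.+1 <= (rho + j%:R) * psi j) ->
  1 <= (rho + 1) * psi n ->
  forall j, (0 < j <= n)%N -> set_fresh n j <= psi j.
Proof.
move=> n0 psi0 psim psiS psin; apply: set_fresh_le_supersolution => j jn.
have [->|jltn] := eqVneq j n.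
  by rewrite pull_rate_nn mul0r !addr0 divff// pnatr_eq0; lia.
have jn' : (0 < j < n)%N by lia.
have := psiS _ jn'; have := psim _ jn'; have := psi0 _ jn.
have := pull_rate_le R jn.
have : 0 <= j%:R / n%:R :> R by rewrite divr_ge0.
by nra.
Qed.
End Recurrence.

(** * Elementary bounds for powers and logarithms *)

Section Bernoulli.
Variable R : realType.

(** Young's inequality for the product of [y ^ r] and [1], with conjugate exponents [1 / r] and
    [1 / (1 - r)]. *)
Lemma powR_le_bernoulli (r y : R) : 0 < r < 1 -> 0 <= y ->
  y `^ r <= 1 + r * (y - 1).
Proof.
move=> /andP[r0 r1] y0.
have := @conjugate_powR R (y `^ r) 1 r^-1 (1 - r)^-1 (powR_ge0 _ _) ler01.
rewrite !invr_gt0 !invrK subr_gt0 => /(_ r0 r1).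
rewrite -powRrM divff ?gt_eqF// powRr1// powR1 mulr1 => /(_ _)/le_trans; apply; lra.
Qed.

Lemma ln_le_sub1 (x : R) : 0 < x -> ln x <= x - 1.
Proof. by move=> x0; have := @le_ln1Dx R (x - 1); rewrite subrKC; apply; lra. Qed.

(** Both sides come from [ln x <= x - 1], at [x = j / (j + 1)] and at [x = (j + 1) / j]. *)
Lemma ln_succ_bounds (j : nat) : (0 < j)%N ->
  j.+1%:R^-1 <= ln (j.+1%:R : R) - ln j%:R <= j%:R^-1.
Proof.
move=> j0; have J0 : 0 < j%:R :> R by rewrite ltr0n.
have J1 : 0 < j.+1%:R :> R by rewrite ltr0n.
apply/andP; split.
  have := @ln_le_sub1 (j%:R / j.+1%:R) (divr_gt0 J0 J1).
  rewrite ln_div ?posrE//; suff -> : j%:R / j.+1%:R - 1 = - j.+1%:R^-1 :> R by rewrite -opprB lerN2.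
  by rewrite -[j.+1]addn1 natrD; field; lra.
have := @ln_le_sub1 (j.+1%:R / j%:R) (divr_gt0 J1 J0).
rewrite ln_div ?posrE//; suff -> : j.+1%:R / j%:R - 1 = j%:R^-1 :> R by [].
by rewrite -[j.+1]addn1 natrD; field; lra.
Qed.
End Bernoulli.

(** * Order of magnitude of the equilibrium in the three regimes *)

Section Asymptotics.
Variable R : realType.
Implicit Types (r : R) (n j : nat).

(** A concave power lies below its tangent at [a]; this is Bernoulli's inequality at [b / a],
    multiplied by [a] to clear the denominator. *)
Lemma powR_tangent r (a b : R) : 0 < r < 1 -> 0 < a -> 0 <= b ->
  a * b `^ r <= a `^ r * (a + r * (b - a)).
Proof.
move=> r01 a0 b0.
have -> : a `^ r * (a + r * (b - a)) = a * (a `^ r * (1 + r * (b / a - 1))).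
  by field; lra.
have -> : b `^ r = a `^ r * (b / a) `^ r.
  by rewrite -powRM ?divr_ge0// ?(ltW a0)// mulrC divfK ?gt_eqF.
rewrite ler_pM2l//.
by rewrite ler_wpM2l ?powR_ge0// powR_le_bernoulli ?divr_ge0// ?(ltW a0).
Qed.

Lemma set_fresh_ub_gt1 r n : 1 < r -> (1 < n)%N ->
  set_fresh r n 1 <= (r - 1)^-1 * n%:R^-1.
Proof.
move=> r1 n1; have N0 : 0 < n%:R :> R by rewrite ltr0n; lia.
(* With [j] in place of the pull rate, [a (j / n)] solves the recurrence exactly when
   [a (r - 1) = 1]. *)
pose psi j : R := (r - 1)^-1 * (j%:R / n%:R).
have a0 : 0 < (r - 1)^-1 by rewrite invr_gt0; lra.
have -> : (r - 1)^-1 * n%:R^-1 = psi 1%N by rewrite /psi mul1r.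
apply: (@set_fresh_le_monotone R r (lt_trans ltr01 r1) n psi); rewrite /psi; try lia.
- by move=> j _; rewrite mulr_ge0 ?divr_ge0// ltW.
- by move=> j _; rewrite ler_pM2l// ler_pM2r ?invr_gt0// ler_nat.
- move=> j _; rewrite -natr1 le_eqVlt; apply/orP; left; apply/eqP.
  by field; lra.
- rewrite divff; last by lra.
  by rewrite mulr1 -(ler_pM2r (_ : 0 < r - 1)) ?divfK; lra.
Qed.

(** Dropping the nonnegative gossip term from the recurrence at [j = 1] leaves [1 / n] over a total
    rate of at most [r + 2]. *)
Lemma set_fresh_lb r n : 0 < r -> (1 < n)%N ->
  (r + 2)^-1 * n%:R^-1 <= set_fresh r n 1.
Proof.
move=> r0 n1; have N1 : 1 < n%:R :> R by rewrite ltr1n; lia.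
have B0 := total_rate_gt0 r0 n 1.
have n1' : (0 < 1 <= n)%N by lia.
rewrite -(ler_pM2l B0) set_freshE; [|exact: r0|lia].
have := mulr_ge0 (pull_rate_ge0 R n 1) (set_fresh_ge0 r0 (_ : 0 < 2 <= n)%N).
have := pull_rate_le R n1'; move: (pull_rate n 1) (set_fresh r n 2) => c f c1 /(_ n1) cf.
apply: (@le_trans _ _ (1 / n%:R)); last lra.
rewrite mulrA ler_pM2r ?invr_gt0; last lra.
rewrite ler_pdivrMr ?mul1r; last lra.
have : 1 / n%:R <= 1 :> R by rewrite ler_pdivrMr; lra.
by lra.
Qed.

Lemma set_fresh_ub_lt1 r n : 0 < r < 1 -> (1 < n)%N ->
  set_fresh r n 1 <= (r * (1 - r))^-1 * n%:R `^ (- r).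
Proof.
move=> r01 n1; have N0 : 0 < n%:R :> R by rewrite ltr0n; lia.
have /andP[r0 r1] := r01.
pose y j : R := (j%:R / n%:R) `^ r.
(* With [j] in place of the pull rate, [- (j / n) / (1 - r)] is an exact particular solution, and
   [y] is a supersolution of the homogeneous recurrence. The weight [1 / r] on [y] makes the
   difference nonnegative and monotone. *)
pose psi j : R := (1 - r)^-1 * (y j / r - j%:R / n%:R).
have a0 : 0 < (1 - r)^-1 by rewrite invr_gt0; lra.
have y_ge j : (j <= n)%N -> j%:R / n%:R <= y j.
  move=> jn; case: j jn => [|j] jn; first by rewrite mul0r powR_ge0.
  rewrite -{1}(@powRr1 _ (j.+1%:R / n%:R)) ?divr_ge0//; apply: ger_powR; last exact: ltW.
  apply/andP; split; first by rewrite divr_gt0// ltr0n.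
  by rewrite ler_pdivrMr// mul1r ler_nat.
have X0 j : 0 <= j%:R / n%:R :> R by rewrite divr_ge0.
have XS j : j.+1%:R / n%:R = j%:R / n%:R + n%:R^-1 :> R.
  by rewrite -natr1 mulrDl mul1r.
have V0 : 0 < n%:R^-1 :> R by rewrite invr_gt0.
(* Tangent at [j / n], evaluated at [(j + 1) / n]. *)
have yU j : (0 < j)%N -> j%:R * y j.+1 <= (r + j%:R) * y j.
  move=> j0; have J0 : 0 < j%:R :> R by rewrite ltr0n.
  have := @powR_tangent r _ (j.+1%:R / n%:R) r01 (divr_gt0 J0 N0) (X0 _).
  rewrite -/(y j) -/(y j.+1) XS -(ler_pM2r N0).
  have -> : j%:R / n%:R * y j.+1 * n%:R = j%:R * y j.+1 by field; lra.
  have -> // : y j * (j%:R / n%:R + r * (j%:R / n%:R + n%:R^-1 - j%:R / n%:R)) * n%:R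
         = (r + j%:R) * y j by field; lra.
(* Tangent at [(j + 1) / n], evaluated at [j / n]; [y_ge] bounds its slope below by [r]. *)
have yD j : (j < n)%N -> r / n%:R <= y j.+1 - y j.
  move=> jn; have J0 : 0 < j.+1%:R / n%:R :> R by rewrite divr_gt0// ltr0n.
  have := @powR_tangent r _ (j%:R / n%:R) r01 J0 (X0 _).
  rewrite -/(y j) -/(y j.+1) => T.
  rewrite -(ler_pM2l J0); have := y_ge _ jn; move: T J0; rewrite XS.
  set x := j%:R / n%:R; set v := n%:R^-1; move=> T J0 Y.
  have rv : 0 < r * v by rewrite mulr_gt0.
  have : (x + v) * (r * v) <= y j.+1 * (r * v) by rewrite ler_pM2r.
  by rewrite -/v; lra.
have -> : (r * (1 - r))^-1 * n%:R `^ (- r) = (1 - r)^-1 * (y 1%N / r).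
  rewrite /y mul1r powRN -(powR_inv1 (ltW N0)) -powRrM mulN1r powRN.
  have : 0 < n%:R `^ r by rewrite powR_gt0.
  by move=> ?; field; lra.
apply: (@le_trans _ _ (psi 1%N)); last first.
  by rewrite ler_pM2l// gerBl X0.
apply: (@set_fresh_le_monotone R r r0 n psi); rewrite /psi; try lia.
- move=> j /andP[_ jn]; rewrite mulr_ge0 ?(ltW a0)// subr_ge0.
  apply: le_trans (y_ge _ jn) _.
  by rewrite ler_peMr ?powR_ge0// invf_ge1 ?ltW.
- move=> j /andP[_ jn]; rewrite ler_pM2l// XS.
  have : r / n%:R / r <= (y j.+1 - y j) / r by rewrite ler_pM2r ?invr_gt0// yD.
  rewrite mulrAC divff ?gt_eqF// mul1r mulrBl.
  by move: (y j / r) (y j.+1 / r) (n%:R^-1) (j%:R / n%:R) => *; lra.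
- move=> j /andP[j0 jn]; have := yU _ j0.
  rewrite -(ler_pM2r (_ : 0 < (1-r)^-1 / r)) ?divr_gt0// => H.
  rewrite -subr_ge0 XS.
  suff -> : (r + j%:R) * ((1 - r)^-1 * (y j / r - j%:R / n%:R)) -
   (j%:R / n%:R + j%:R * ((1 - r)^-1 * (y j.+1 / r - (j%:R / n%:R + n%:R^-1)))) =
   (r + j%:R) * y j * ((1 - r)^-1 / r) - j%:R * y j.+1 * ((1 - r)^-1 / r).
    by rewrite subr_ge0.
  by field; lra.
- rewrite /y divff ?lt0r_neq0// powR1.
  suff -> : (r + 1) * ((1 - r)^-1 * (1 / r - 1)) = 1 + r^-1.
    by rewrite lerDl ltW ?invr_gt0.
  by field; lra.
Qed.

Lemma set_fresh_lb_lt1 r n : 0 < r < 1 -> (1 < n)%N ->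
  r `^ r / 6 * n%:R `^ (- r) - (2 * (1 - r))^-1 * n%:R^-1 <= set_fresh r n 1.
Proof.
move=> r01 n1; have N1 : 2 <= n%:R :> R by rewrite ler_nat.
have /andP[r0 r1] := r01.
pose v : R := n%:R `^ (- r).
have v0 : 0 < v by rewrite powR_gt0; lra.
(* The shift by [r - 1] makes [g] satisfy [(j + r) g_j <= j g_(j+1)]; the plain
   power [j^r] satisfies the reverse inequality. *)
pose g j : R := (j%:R - 1 + r) `^ r.
pose be := (2 * (1 - r))^-1.
have be0 : 0 < be by rewrite invr_gt0; lra.
have beE : be * (1 - r) = 1 / 2 by rewrite /be; field; lra.
(* The source term [j / n] is split in halves. Since [be (1 - r) = 1 / 2], the linear part costs at
   most one half; the power part leaves an error of at most [3 (j / n)], and division by 6 makes it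
   the other half. *)
pose psi j : R := g j / 6 * v - be * (j%:R / n%:R).
have -> : r `^ r / 6 * n%:R `^ (- r) - (2 * (1 - r))^-1 * n%:R^-1 = psi 1%N.
  by rewrite /psi /g subrr add0r mul1r.
apply: (@set_fresh_ge_subsolution R r r0 n psi); last exact: (ltnW n1).
move=> j /andP[j0 jn]; have J1 : 1 <= j%:R :> R by rewrite ler1n.
have JN : j%:R <= n%:R :> R by rewrite ler_nat.
have G0 : 0 < g j by rewrite powR_gt0; lra.
have g1 : (j%:R + r) * g j <= j%:R * g j.+1.
  have := @powR_tangent r (j%:R + r) (j%:R - 1 + r) r01.
  rewrite -/(g j) /g -natr1 addrK => /(_ _ _)/le_trans; apply; lra.
have g2 : (j%:R - 1 + r) * g j.+1 <= g j * (j%:R - 1 + r * 2).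
  have := @powR_tangent r (j%:R - 1 + r) (j%:R + r) r01.
  rewrite -/(g j) /g -natr1 addrK => /(_ _ _)/le_trans; apply; lra.
have gv : g j * v <= 1.
  rewrite /v powRN ler_pdivrMr; last by apply: powR_gt0; lra.
  rewrite mul1r.
  by apply: ge0_ler_powR; rewrite ?nnegrE; lra.
have gm : g j <= g j.+1.
  by rewrite /g -natr1; apply: ge0_ler_powR; rewrite ?nnegrE; lra.
have g3 : (j%:R - 1) * (g j.+1 - g j) <= r * g j by nra.
have c_le : pull_rate n j <= j%:R :> R by apply: pull_rate_le; rewrite j0.
(* Error of using [j] for the pull rate; the factor 2 bounds [n / (n - 1)]. *)
have e_le : (j%:R - pull_rate n j) * (g j.+1 - g j) <= 2 * (j%:R / n%:R) * (r * g j).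
  rewrite pull_rateE// opprB addrC subrK.
  have -> : j%:R * (j%:R - 1) / (n%:R - 1) * (g j.+1 - g j) =
     j%:R / (n%:R - 1) * ((j%:R - 1) * (g j.+1 - g j)) by field; lra.
  apply: (@le_trans _ _ (j%:R / (n%:R - 1) * (r * g j))).
    by rewrite ler_wpM2l// divr_ge0; lra.
  apply: ler_wpM2r; first by rewrite mulr_ge0// ltW.
  rewrite ler_pdivrMr; last by lra.
  have -> : 2 * (j%:R / n%:R) * (n%:R - 1) = j%:R * (2 * (n%:R - 1) / n%:R) :> R by field; lra.
  by apply: ler_peMr => //; rewrite ler_pdivlMr; lra.
have cj : 0 < j%:R / n%:R :> R by rewrite divr_gt0; lra.
have -> : psi j.+1 = g j.+1 / 6 * v - be * (j%:R / n%:R) - be / n%:R.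
  by rewrite /psi -natr1; field; lra.
rewrite /psi.
have cbe : pull_rate n j * (be / n%:R) <= be * (j%:R / n%:R).
  rewrite mulrCA ler_pM2l// ler_pM2r ?invr_gt0; last lra.
  exact: c_le.
move: cbe c_le e_le; set w := be / n%:R.
move: (pull_rate n j) (j%:R / n%:R) cj => c x x0 cw c_le e_le.
have {}e_le := ler_wpM2r (ltW v0) e_le.
have {}g1 := ler_wpM2r (ltW v0) g1.
have xgv : x * (g j * v) * (1 + 2 * r) <= 3 * x.
  have : x * (g j * v) <= x by rewrite ler_piMr// ltW.
  have := mulr_gt0 x0 (mulr_gt0 G0 v0).
  by nra.
have bx : be * x * (1 - r) = x / 2 by rewrite mulrAC beE; lra.
have bxx : 0 <= be * x * x by rewrite !mulr_ge0 ?ltW.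
by lra.
Qed.

(** With [j] in place of the pull rate, [j / n] now solves the homogeneous recurrence, hence the
    extra factor [1 + ln (n / j)]. The supersolution inequality reduces to
    [1 / (j + 1) <= ln (j + 1) - ln j]; monotonicity uses the upper bound [1 / j]. *)
Lemma set_fresh_ub_eq1 n : (1 < n)%N ->
  set_fresh (1 : R) n 1 <= (1 + ln n%:R) / n%:R.
Proof.
move=> n1; have N0 : 0 < n%:R :> R by rewrite ltr0n; lia.
pose L j : R := ln n%:R - ln j%:R.
pose psi j : R := j%:R / n%:R * (1 + L j).
have L0 j : (0 < j <= n)%N -> 0 <= L j.
  by move=> /andP[j0 jn]; rewrite subr_ge0 ler_ln ?posrE ?ltr0n ?ler_nat//; lia.
have -> : (1 + ln n%:R) / n%:R = psi 1%N.
  by rewrite /psi /L ln1 subr0 mul1r mulrC.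
have XS j : j.+1%:R / n%:R = j%:R / n%:R + n%:R^-1 :> R.
  by rewrite -natr1 mulrDl mul1r.
have V0 : 0 < n%:R^-1 :> R by rewrite invr_gt0.
apply: (@set_fresh_le_monotone R 1 ltr01 n psi); rewrite /psi; try lia.
- by move=> j jn; rewrite mulr_ge0 ?divr_ge0// addr_ge0// L0.
- move=> j /andP[j0 jn]; have J0 : 0 < j%:R :> R by rewrite ltr0n.
  have /andP[_] := ln_succ_bounds R j0; have L'0 := L0 j.+1 jn.
  have -> : ln j.+1%:R - ln j%:R = L j - L j.+1 :> R by rewrite /L; ring.
  rewrite -(ler_pM2l J0) divff ?lt0r_neq0// => H.
  rewrite mulrAC [X in _ <= X]mulrAC ler_pM2r// -natr1; lra.
- move=> j /andP[j0 jn]; have J0 : 0 < j%:R :> R by rewrite ltr0n.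
  have /andP[+ _] := ln_succ_bounds R j0.
  have -> : ln j.+1%:R - ln j%:R = L j - L j.+1 :> R by rewrite /L; ring.
  have J1 : 0 < j.+1%:R :> R by rewrite ltr0n.
  rewrite -(ler_pM2l J1) divff ?lt0r_neq0//.
  rewrite -(ler_pM2r (divr_gt0 J0 N0)) mul1r -natr1 => H.
  have -> : j%:R * ((j%:R + 1) / n%:R * (1 + L j.+1)) =
    (j%:R + 1) * (1 + L j.+1) * (j%:R / n%:R) by ring.
  by move: H; lra.
- by rewrite divff ?lt0r_neq0// /L subrr; lra.
Qed.

Lemma set_fresh_lb_eq1 n : (1 < n)%N ->
  ln n%:R / n%:R / 4 <= set_fresh (1 : R) n 1.
Proof.
move=> n1; have N1 : 2 <= n%:R :> R by rewrite ler_nat.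
pose L j : R := ln n%:R - ln j%:R.
pose psi j : R := j%:R / n%:R * L j / 4.
have L0 j : (0 < j <= n)%N -> 0 <= L j.
  by move=> /andP[j0 jn]; rewrite subr_ge0 ler_ln ?posrE ?ltr0n ?ler_nat//; lia.
have -> : ln n%:R / n%:R / 4 = psi 1%N.
  by rewrite /psi /L ln1 subr0 mul1r [_^-1 * _]mulrC.
apply: (@set_fresh_ge_subsolution R 1 ltr01 n psi); last exact: (ltnW n1).
move=> j jn; have J1 : 1 <= j%:R :> R by rewrite ler1n; lia.
have JN : j%:R <= n%:R :> R by rewrite ler_nat; lia.
have [ejn|jln] := eqVneq j n.
  rewrite ejn pull_rate_nn /psi /L subrr mulr0 !mul0r mulr0 addr0 divr_ge0//.
have x0 : 0 < j%:R / n%:R :> R by rewrite divr_gt0; lra.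
have xL : j%:R / n%:R * L j <= 1.
  have J0 : 0 < j%:R :> R by lra.
  have N0 : 0 < n%:R :> R by lra.
  have := ln_le_sub1 (divr_gt0 N0 J0); rewrite ln_div ?posrE// -/(L j) => H.
  have {}H : L j <= n%:R / j%:R by apply: le_trans H _; rewrite gerBl.
  have := H; rewrite -(ler_pM2l x0) => /le_trans; apply.
  suff -> : j%:R / n%:R * (n%:R / j%:R) = 1 :> R by [].
  by field; lra.
have /andP[+ dU] : j.+1%:R^-1 <= L j - L j.+1 <= j%:R^-1.
  have -> : L j - L j.+1 = ln j.+1%:R - ln j%:R :> R by rewrite /L; ring.
  by apply: ln_succ_bounds; lia.
have : 0 < j.+1%:R^-1 :> R by rewrite invr_gt0 ltr0n.
move=> i0 dL; have {i0 dL} d0 := lt_le_trans i0 dL.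
have L'0 : 0 <= L j.+1 by apply: L0; lia.
have {}dU : j%:R * (L j - L j.+1) <= 1.
  by have := ler_wpM2l (_ : 0 <= j%:R) dU; rewrite divff; lra.
have [cL cU] : j%:R - j%:R * (j%:R / n%:R) <= pull_rate n j :> R /\ pull_rate n j <= j%:R :> R.
  split; last by apply: pull_rate_le.
  rewrite pull_rateE//; last lia.
  rewrite lerD2l lerN2 -mulrA ler_pM2l; last lra.
  rewrite ler_pdivrMr; last lra.
  rewrite mulrAC ler_pdivlMr; lra.
have XS : j.+1%:R / n%:R = j%:R / n%:R + n%:R^-1 :> R by rewrite -natr1 mulrDl mul1r.
rewrite /psi XS {XS}.
have V0 : 0 < n%:R^-1 :> R by rewrite invr_gt0; lra.
move: (n%:R^-1) (pull_rate n j) cL cU V0 x0 xL => v c cL cU v0 x0 xL.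
move: dU d0; set l := L j; set l' := L j.+1 => dU d0.
have lx : l' * (j%:R * v) <= 1.
  by apply: le_trans xL; rewrite mulrC ler_pM2l// -subr_ge0 ltW.
(* After multiplication by 4, the subsolution inequality leaves four error terms, each at most
   [j / n]; this is the origin of the divisor 4 in [psi]. *)
have A1 : c * (j%:R * v * (l - l')) <= j%:R * (j%:R * v * (l - l')).
  by rewrite ler_wpM2r// mulr_ge0 ?ltW.
have A2 : (j%:R - j%:R * (j%:R * v)) * (v * l') <= c * (v * l').
  by rewrite ler_wpM2r// mulr_ge0// ltW.
have A3 : (j%:R * v) * (j%:R * (l - l')) <= (j%:R * v) * 1 by rewrite ler_pM2l.
have A4 : (j%:R * v) * (l - l') <= (j%:R * v) * (j%:R * (l - l')).
  by rewrite ler_pM2l// ler_peMl// ltW.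
have A5 : (j%:R * v) * (l' * (j%:R * v)) <= (j%:R * v) * 1 by rewrite ler_pM2l.
have A6 : (j%:R * v) * (j%:R * v * l) <= (j%:R * v) * 1 by rewrite ler_pM2l.
by lra.
Qed.

Lemma set_fresh_theta_gt1 r : 1 < r ->
  theta_eventually (fun n => set_fresh r n 1) (fun n => n%:R^-1).
Proof.
move=> r1; exists (r + 2)^-1, (r - 1)^-1; rewrite !invr_gt0.
split; [lra|split; [lra|exists 2%N => n n2]].
by split; [apply: set_fresh_lb => //; lra|apply: set_fresh_ub_gt1].
Qed.

Lemma set_fresh_theta_eq1 :
  theta_eventually (fun n => set_fresh (1 : R) n 1) (fun n => ln n%:R / n%:R).
Proof.
exists 4^-1, 3; split; [lra|split; [lra|exists 2%N => n n2]].
split; first by rewrite mulrC; apply: set_fresh_lb_eq1.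
apply: le_trans (set_fresh_ub_eq1 n2) _.
have N2 : 2 <= n%:R :> R by rewrite ler_nat.
rewrite mulrA ler_pM2r ?invr_gt0; last lra.
(* Hence [1 <= 2 * ln n], which turns [1 + ln n] into at most [3 * ln n]. *)
have : 2^-1 <= ln 2 :> R.
  by have /andP[] := ln_succ_bounds R (ltn0Sn 0); rewrite ln1 subr0.
have : ln 2 <= ln n%:R :> R by rewrite ler_ln ?posrE; lra.
by lra.
Qed.

Lemma set_fresh_theta_lt1 r : 0 < r < 1 ->
  theta_eventually (fun n => set_fresh r n 1) (fun n => n%:R `^ (- r)).
Proof.
move=> r01; have /andP[r0 r1] := r01.
have rr0 : 0 < r `^ r by rewrite powR_gt0.
(* Once [n ^ (1 - r)] exceeds [K], half of the leading term [r ^ r / 6 * n ^ (- r)] absorbs the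
   negative [1 / n] term; the other half gives the constant [r ^ r / 12]. *)
pose K := 6 / ((1 - r) * r `^ r).
have K0 : 0 < K by rewrite divr_gt0// mulr_gt0; lra.
exists (r `^ r / 12), (r * (1 - r))^-1.
split; [lra|split; first by rewrite invr_gt0 mulr_gt0; lra].
exists (maxn 2 (Num.bound (K `^ (1 - r)^-1))) => n; rewrite geq_max => /andP[n2 nK].
split; last by apply: set_fresh_ub_lt1.
apply: le_trans (set_fresh_lb_lt1 r01 n2).
have N2 : 2 <= n%:R :> R by rewrite ler_nat.
have KN : K <= n%:R `^ (1 - r).
  have -> : K = (K `^ (1 - r)^-1) `^ (1 - r).
    by rewrite -powRrM mulVf ?powRr1 ?ltW//; lra.
  apply: ge0_ler_powR; rewrite ?nnegrE ?powR_ge0//; try lra.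
  apply/ltW/(lt_le_trans (archi_boundP (powR_ge0 _ _))).
  by rewrite ler_nat.
have -> : n%:R `^ (- r) = n%:R `^ (1 - r) / n%:R :> R.
  by rewrite -{3}(@powRr1 _ n%:R)// -powRN -powRD; [congr (_ `^ _); ring|apply/implyP; lra].
move: (n%:R `^ (1 - r)) KN => u Ku.
rewrite -mulrA; rewrite !mulrA -mulrBl ler_pM2r ?invr_gt0; last lra.
have : r `^ r / 12 * K <= r `^ r / 12 * u by rewrite ler_pM2l; lra.
have -> : r `^ r / 12 * K = (2 * (1 - r))^-1 by rewrite /K; field; lra.
by lra.
Qed.
End Asymptotics.

(** * The semigroup as an exponential series, and its generator on freshness indicators *)

Section Semigroup.
Variables (R : realType) (lam_e lam : R) (n : nat).
Implicit Types (h : fstate n -> R) (x y : fstate n) (S : {set 'I_n}).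

Definition gen_app h x : R := \sum_y fgen lam_e lam x y * h y.

(** The sum of all entries is a crude but submultiplicative matrix norm, enough to dominate the
    exponential series. *)
Definition gen_norm : R := \sum_(x : fstate n) \sum_(y : fstate n) `|fgen lam_e lam x y|.

Lemma gen_norm_ge0 : 0 <= gen_norm.
Proof. by apply: sumr_ge0 => x _; apply: sumr_ge0. Qed.

Lemma fgen_pow_le k x y : `|fgen_pow lam_e lam k x y| <= gen_norm ^+ k.
Proof.
elim: k y => [|k IH] y /=; first by rewrite expr0 normr_nat lern1 leq_b1.
apply: le_trans (ler_norm_sum _ _ _) _.
apply: (@le_trans _ _ (\sum_z gen_norm ^+ k * `|fgen lam_e lam z y|)).
  by apply: ler_sum => z _; rewrite normrM ler_wpM2r.
rewrite -mulr_sumr exprSr ler_wpM2l ?exprn_ge0 ?gen_norm_ge0//.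
apply: ler_sum => z _; rewrite (bigD1 y)//= lerDl; exact: sumr_ge0.
Qed.

Lemma is_cvg_exp_series (u : nat -> R) (C M t : R) : 0 <= C -> 0 <= M ->
  (forall k, `|u k| <= C * M ^+ k) ->
  cvgn (series (fun k => t ^+ k / k`!%:R * u k)).
Proof.
move=> C0 M0 uM; apply: normed_cvg.
apply: (@series_le_cvg _ _ (C *: exp_coeff (M * `|t|))).
- by move=> k; apply: normr_ge0.
- by move=> k; rewrite /exp_coeff/= mulr_ge0 ?divr_ge0 ?exprn_ge0 ?mulr_ge0.
- move=> k; rewrite /= normrM [leLHS]mulrC.
  apply: le_trans (ler_wpM2r (normr_ge0 _) (uM k)) _.
  rewrite le_eqVlt; apply/orP; left; apply/eqP.
  transitivity (C * ((M * `|t|) ^+ k / k`!%:R)); last by [].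
  by rewrite normrM normrX normfV normr_nat exprMn; ring.
- exact: is_cvg_seriesZ (is_cvg_series_exp_coeff _).
Qed.

(** The pairing of [p0] with the [k]-th generator power applied to [h]: the [k]-th derivative of the
    mean at time 0. *)
Definition moment (p0 : fstate n -> R) h (k : nat) : R :=
  \sum_x \sum_y p0 x * fgen_pow lam_e lam k x y * h y.

Definition mean_of (p0 : fstate n -> R) h (t : R) : R :=
  \sum_x \sum_y p0 x * Defs.ftrans lam_e lam t x y * h y.

Variable p0 : fstate n -> R.

(** Associativity moves one factor of the generator onto [h], so that shifting Taylor coefficients
    amounts to replacing [h] by [gen_app h]. *)
Lemma momentS h k : moment p0 h k.+1 = moment p0 (gen_app h) k.
Proof.
apply: eq_bigr => x _ /=; under eq_bigr do rewrite mulr_sumr mulr_suml.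
rewrite exchange_big; apply: eq_bigr => z _; rewrite mulr_sumr.
by apply: eq_bigr => y _; ring.
Qed.

Lemma moment_le h k :
  `|moment p0 h k| <= (\sum_x \sum_y `|p0 x| * `|h y|) * gen_norm ^+ k.
Proof.
rewrite mulr_suml; apply: le_trans (ler_norm_sum _ _ _) _; apply: ler_sum => x _.
rewrite mulr_suml; apply: le_trans (ler_norm_sum _ _ _) _; apply: ler_sum => y _.
rewrite !normrM mulrAC ler_wpM2l ?mulr_ge0//; exact: fgen_pow_le.
Qed.

Lemma is_cvg_moment_series h t :
  cvgn (series (fun k => t ^+ k / k`!%:R * moment p0 h k)).
Proof.
apply: is_cvg_exp_series gen_norm_ge0 (moment_le h).
by apply: sumr_ge0 => x _; apply: sumr_ge0 => y _; rewrite mulr_ge0.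
Qed.

Lemma mean_of_series h t :
  mean_of p0 h t = limn (series (fun k => t ^+ k / k`!%:R * moment p0 h k)).
Proof.
apply/esym/cvg_lim => //.
have -> : series (fun k => t ^+ k / k`!%:R * moment p0 h k) = (fun m =>
   \sum_x \sum_y p0 x * series (fun k => t ^+ k / k`!%:R * fgen_pow lam_e lam k x y) m * h y).
  apply/funext => m; rewrite /series/= /moment.
  under eq_bigr do rewrite mulr_sumr.
  rewrite exchange_big; apply: eq_bigr => x _.
  under eq_bigr do rewrite mulr_sumr.
  rewrite exchange_big; apply: eq_bigr => y _.
  rewrite mulr_sumr mulr_suml; apply: eq_bigr => k _; ring.
apply: cvg_big => [|x _]; first exact: add_continuous.
apply: cvg_big => [|y _]; first exact: add_continuous.
apply: cvgM; last exact: cvg_cst.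
apply: cvgM; first exact: cvg_cst.
apply: (@is_cvg_exp_series _ 1 gen_norm) => //; first exact: gen_norm_ge0.
by move=> k; rewrite mul1r fgen_pow_le.
Qed.

(** Kolmogorov's equation in weak form, by termwise differentiation of the power series and
    [momentS]. *)
Lemma is_derive_mean_of h (t : R) :
  is_derive t (1 : R) (mean_of p0 h) (mean_of p0 (gen_app h) t).
Proof.
pose c h k := moment p0 h k / k`!%:R.
have cE h' s : series (fun k => s ^+ k / k`!%:R * moment p0 h' k) = pseries (c h') s.
  by congr series; apply/funext => k /=; rewrite /c; ring.
have cD h' : pseries_diffs (c h') = c (gen_app h').
  apply/funext => k; rewrite /pseries_diffs /c momentS factS natrM.
  have K1 : k.+1%:R != 0 :> R by rewrite pnatr_eq0.
  by rewrite invfM mulrCA !mulrA mulfK.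
have -> : mean_of p0 h = fun s => limn (pseries (c h) s).
  by apply/funext => s; rewrite mean_of_series cE.
rewrite mean_of_series cE -cD.
(* The series and its first two formal derivatives must converge at a point of modulus larger than
   that of [t]. *)
apply: (@pseries_snd_diffs _ (c h) (`|t| + 1)).
- by rewrite -cE; exact: is_cvg_moment_series.
- by rewrite cD -cE; exact: is_cvg_moment_series.
- by rewrite !cD -cE; exact: is_cvg_moment_series.
- by rewrite (ger0_norm (_ : 0 <= `|t| + 1)) ?addr_ge0// ltrDl.
Qed.

Lemma eq_mean_of h h' t : h =1 h' -> mean_of p0 h t = mean_of p0 h' t.
Proof. by move=> hh'; apply: eq_bigr => x _; apply: eq_bigr => y _; rewrite hh'. Qed.

Lemma mean_ofD h h' t :
  mean_of p0 (fun x => h x + h' x) t = mean_of p0 h t + mean_of p0 h' t.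
Proof.
rewrite -big_split; apply: eq_bigr => x _; rewrite -big_split.
by apply: eq_bigr => y _; rewrite mulrDr.
Qed.

Lemma mean_ofZ a h t : mean_of p0 (fun x => a * h x) t = a * mean_of p0 h t.
Proof.
rewrite mulr_sumr; apply: eq_bigr => x _; rewrite mulr_sumr.
by apply: eq_bigr => y _; ring.
Qed.

Lemma mean_of_sum (I : finType) (P : pred I) (h : I -> fstate n -> R) t :
  mean_of p0 (fun x => \sum_(i | P i) h i x) t = \sum_(i | P i) mean_of p0 (h i) t.
Proof.
rewrite exchange_big; apply: eq_bigr => x _; rewrite exchange_big.
by apply: eq_bigr => y _; rewrite mulr_sumr.
Qed.

(** Zero row sums let the generator act on differences [h y - h x]; these vanish at [y = x], so
    events without effect contribute nothing. *)
Lemma gen_appE h x : gen_app h x = lam_e * (h (ev_gen n) - h x)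
  + \sum_(j : 'I_n) lam / n%:R * (h (ev_src j x) - h x)
  + \sum_(i : 'I_n) \sum_(j : 'I_n | j != i)
      lam / n.-1%:R * (h (ev_gossip i j x) - h x).
Proof.
have pick a (e : fstate n) : \sum_y a * (e == y)%:R * (h y - h x) = a * (h e - h x).
  rewrite (bigD1 e)//= eqxx mulr1 big1 ?addr0// => y ye.
  by rewrite eq_sym (negbTE ye) mulr0 mul0r.
transitivity (\sum_y frate lam_e lam x y * (h y - h x)).
  rewrite /gen_app (bigD1 x)//= [RHS](bigD1 x)//= subrr mulr0 add0r.
  rewrite {1}/fgen eqxx mulNr mulr_suml -sumrN -big_split.
  apply: eq_bigr => y yx /=; rewrite /fgen eq_sym (negbTE yx); ring.
under eq_bigr do rewrite /frate !mulrDl !mulr_suml.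
rewrite !big_split/= pick; congr (_ + _ + _).
  by rewrite exchange_big; apply: eq_bigr => j _; exact: pick.
rewrite exchange_big; apply: eq_bigr => i _; under eq_bigr do rewrite mulr_suml.
by rewrite exchange_big; apply: eq_bigr => j _; exact: pick.
Qed.

Definition some_fresh S x : bool := [exists i in S, x i].

(** A new version clears [S], and a source update inside [S] makes it fresh. Gossip matters only
    from some [i] outside [S] to a receiver inside: afterwards [S] has a fresh node exactly when
    [i |: S] had one before. *)
Lemma gen_app_some_fresh S x :
  gen_app (fun x => (some_fresh S x)%:R) x =
  - lam_e * (some_fresh S x)%:R
  + #|S|%:R * (lam / n%:R) * (1 - (some_fresh S x)%:R)
  + \sum_(i | i \notin S) #|S|%:R * (lam / n.-1%:R) *
      ((some_fresh (i |: S) x)%:R - (some_fresh S x)%:R).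
Proof.
rewrite gen_appE; congr (_ + _ + _).
- suff -> : some_fresh S (ev_gen n) = false by rewrite sub0r mulrN mulNr.
  by apply/existsP => -[i]; rewrite ffunE andbF.
- rewrite (bigID (mem S))/= [X in _ + X]big1 ?addr0; last first.
    move=> j jS; suff -> : some_fresh S (ev_src j x) = some_fresh S x by rewrite subrr mulr0.
    apply: eq_existsb => i; rewrite ffunE; case: eqVneq => // ->.
    by rewrite (negbTE jS).
  rewrite (eq_bigr (fun=> lam / n%:R * (1 - (some_fresh S x)%:R))).
    by rewrite sumr_const -[LHS]mulr_natl [LHS]mulrA.
  move=> j jS; suff -> : some_fresh S (ev_src j x) = true by [].
  by apply/existsP; exists j; rewrite ffunE eqxx jS.
- rewrite (bigID (mem S))/= [X in X + _]big1 ?add0r; last first.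
    move=> i iS; apply: big1 => j ji.
    suff -> : some_fresh S (ev_gossip i j x) = some_fresh S x by rewrite subrr mulr0.
    apply/existsP/existsP => -[k /andP[kS]]; rewrite ?ffunE.
      case: eqVneq => [kj|_] xk; last by exists k; rewrite kS.
      case/orP: xk => [xi|xj]; first by exists i; rewrite iS.
      by exists j; rewrite -{1}kj kS.
    by move=> xk; exists k; rewrite ffunE kS; case: eqVneq xk => // -> ->; rewrite orbT.
  apply: eq_bigr => i iS.
  rewrite (bigID (mem S))/= [X in _ + X]big1 ?addr0; last first.
    move=> j /andP[_ jS].
    suff -> : some_fresh S (ev_gossip i j x) = some_fresh S x by rewrite subrr mulr0.
    apply: eq_existsb => k; rewrite ffunE; case: eqVneq => // ->.
    by rewrite (negbTE jS).
  rewrite (eq_bigl (mem S)); last first.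
    move=> j /=; case: (boolP (j \in S)) => jS; rewrite ?andbF ?andbT//.
    by apply/negP => /eqP ji; rewrite -ji jS in iS.
  rewrite (eq_bigr (fun=> lam / n.-1%:R *
      ((some_fresh (i |: S) x)%:R - (some_fresh S x)%:R))).
    by rewrite sumr_const -[LHS]mulr_natl [LHS]mulrA.
  move=> j /= jS; have {}jS : j \in S by [].
  suff -> : some_fresh S (ev_gossip i j x) = some_fresh (i |: S) x by [].
  apply/existsP/existsP => -[k /andP[kS]]; rewrite ?ffunE.
    case: eqVneq => [_|_] xk; last by exists k; rewrite !inE kS orbT.
    case/orP: xk => [xi|xj]; first by exists i; rewrite !inE eqxx.
    by exists j; rewrite !inE jS orbT.
  move: kS; rewrite !inE => /orP[/eqP->|kS] xk.
    by exists j; rewrite ffunE eqxx jS xk.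
  by exists k; rewrite ffunE kS; case: eqVneq xk => // -> ->; rewrite orbT.
Qed.

Lemma gen_app_const (a : R) x : gen_app (fun=> a) x = 0.
Proof.
rewrite gen_appE subrr mulr0 add0r !big1 ?addr0// => [i _|j _].
  by apply: big1 => j _; rewrite mulr0.
by rewrite mulr0.
Qed.

Lemma gen_appD h h' x :
  gen_app (fun x => h x + h' x) x = gen_app h x + gen_app h' x.
Proof. by rewrite -big_split; apply: eq_bigr => y _; rewrite mulrDr. Qed.
End Semigroup.

(** * Exponential convergence to the equilibrium *)

Section Decay.
Variable R : realType.

Lemma is_derive_expRM (a s : R) :
  is_derive s (1 : R) (fun s => expR (a * s)) (a * expR (a * s)).
Proof.
have lin : is_derive s (1 : R) (fun s : R => a * s) a.
  apply: (is_derive_eq (@is_deriveZ R R R id a s 1 1 (is_derive_id s (1 : R)))).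
  by rewrite /GRing.scale/= mulr1.
apply: (is_derive_eq (is_derive1_comp (is_derive_expR (a * s)) lin)).
exact: mulrC.
Qed.

(** The integrating factor [exp (b s)] makes [v] times it nondecreasing on [[0, t]]. *)
Lemma ode_ge0 (v dv : R -> R) (b t : R) :
  (forall s : R, is_derive s (1 : R) v (dv s)) ->
  (forall s, 0 <= s -> 0 <= dv s + b * v s) ->
  0 <= v 0 -> 0 <= t -> 0 <= v t.
Proof.
move=> vD vb v0 t0; pose z s := v s * expR (b * s).
have zD (s : R) : is_derive s (1 : R) z ((dv s + b * v s) * expR (b * s)).
  apply: (is_derive_eq (is_deriveM (vD s) (is_derive_expRM b s))).
  by rewrite /GRing.scale/=; ring.
have : z 0 <= z t.
  apply: (@ger0_derive1_ndecr _ z 0 t) => //.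
  - move=> x; rewrite in_itv/= => /andP[x0 _].
    by rewrite derive1E derive_val mulr_ge0 ?expR_ge0// vb// ltW.
  - by apply: derivable_within_continuous => x _.
rewrite /z mulr0 expR0 mulr1 => /(le_trans v0).
by rewrite pmulr_lge0// expR_gt0.
Qed.

(** The barrier [e s = D exp (- a s)] satisfies [e' + b e = (b - a) e], so [ode_ge0] applies to both
    [e + w] and [e - w]. *)
Lemma ode_decay (w dw : R -> R) (a b D t : R) :
  (forall s : R, is_derive s (1 : R) w (dw s)) ->
  (forall s, 0 <= s -> `|dw s + b * w s| <= (b - a) * (D * expR (- a * s))) ->
  `|w 0| <= D -> 0 <= t -> `|w t| <= D * expR (- a * t).
Proof.
move=> wD wb w0 t0.
pose e s := D * expR (- a * s).
have eD (s : R) : is_derive s (1 : R) e (- a * e s).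
  apply: (is_derive_eq (is_deriveZ D (is_derive_expRM (- a) s))).
  by rewrite /GRing.scale/= /e; ring.
have e0 : e 0 = D by rewrite /e mulr0 expR0 mulr1.
move: w0; rewrite !ler_norml -!/(e _) => /andP[w0l w0u]; apply/andP; split.
  rewrite -subr_ge0 opprK addrC.
  apply: (@ode_ge0 (fun s => e s + w s) (fun s => - a * e s + dw s) b).
  - move=> s s0; have := wb _ s0; rewrite ler_norml -/(e s) => /andP[]; lra.
  - by rewrite e0; lra.
  - exact: t0.
rewrite -subr_ge0.
apply: (@ode_ge0 (fun s => e s - w s) (fun s => - a * e s - dw s) b).
- move=> s s0; have := wb _ s0; rewrite ler_norml -/(e s) => /andP[]; lra.
- by rewrite e0; lra.
- exact: t0.
Qed.

Lemma mean_of_const1 (lam_e lam : R) n (p0 : fstate n -> R) t :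
  is_distr p0 -> mean_of lam_e lam p0 (fun=> 1) t = 1.
Proof.
move=> [_ p01]; rewrite mean_of_series; apply/cvg_lim => //.
(* The partial sum of index 0 is empty; from index 1 on all partial sums equal 1, since the
   generator annihilates constants. *)
rewrite -cvg_shiftS.
rewrite (_ : (fun k => _) = cst (1 : R)); first exact: cvg_cst.
apply/funext => m; rewrite /series/= big_nat_recl// big1 ?addr0.
  rewrite expr0 invr1 !mul1r -[RHS]p01 /moment/=; apply: eq_bigr => x _.
  rewrite (bigD1 x)//= eqxx !mulr1 big1 ?addr0// => y yx.
  by rewrite eq_sym (negbTE yx) mulr0 mul0r.
move=> k _; rewrite momentS; suff -> : moment lam_e lam p0 (gen_app lam_e lam (fun=> 1)) k = 0.
  by rewrite mulr0.
by apply: big1 => x _; apply: big1 => y _; rewrite gen_app_const mulr0.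
Qed.

Variables (lam_e lam : R) (n : nat).
Hypotheses (lam_e_gt0 : 0 < lam_e) (lam_gt0 : 0 < lam) (n_gt1 : (1 < n)%N).

Let rho_gt0 : 0 < lam_e / lam. Proof. exact: divr_gt0. Qed.

Lemma sum_pull_rate (S : {set 'I_n}) :
  \sum_(i | i \notin S) #|S|%:R * (lam / n.-1%:R) = lam * pull_rate n #|S|.
Proof.
rewrite sumr_const -[LHS]mulr_natr.
have -> : #|[pred i | i \notin S]| = (n - #|S|)%N.
  have cS := cardC (mem S); rewrite card_ord in cS.
  by rewrite -[RHS]/(n - #|mem S|)%N -[X in (X - _)%N]cS addKn; apply: eq_card.
by rewrite /pull_rate; ring.
Qed.

(** Subtracting the equilibrium makes the linear system homogeneous. *)
Definition centered (S : {set 'I_n}) (x : fstate n) : R :=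
  (some_fresh S x)%:R - set_fresh (lam_e / lam) n #|S|.

Lemma gen_app_centered (S : {set 'I_n}) x :
  gen_app lam_e lam (centered S) x =
  - (lam_e + #|S|%:R * (lam / n%:R) + lam * pull_rate n #|S|) * centered S x
  + \sum_(i | i \notin S) #|S|%:R * (lam / n.-1%:R) * centered (i |: S) x.
Proof.
rewrite (_ : centered S = fun x => (some_fresh S x)%:R +
    - set_fresh (lam_e / lam) n #|S|); last by [].
rewrite gen_appD gen_app_const addr0 gen_app_some_fresh.
have Sn : (#|S| <= n)%N by rewrite -[n in leqRHS]card_ord max_card.
(* All sets [i |: S] have size [#|S| + 1] and share one equilibrium value; the leftover constants
   cancel by [lam] times the recurrence. *)
rewrite (eq_bigr (fun i => #|S|%:R * (lam / n.-1%:R) * centered (i |: S) x +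
    #|S|%:R * (lam / n.-1%:R) *
      (set_fresh (lam_e / lam) n #|S|.+1 - (some_fresh S x)%:R))); last first.
  by move=> i iS; rewrite /centered cardsU1 iS; ring.
rewrite big_split -mulr_suml/= sum_pull_rate /centered.
have /(congr1 (fun u => lam * u)) := set_freshE rho_gt0 Sn.
have -> : lam * ((lam_e / lam + #|S|%:R / n%:R + pull_rate n #|S|) *
     set_fresh (lam_e / lam) n #|S|) =
  (lam_e + #|S|%:R * (lam / n%:R) + lam * pull_rate n #|S|) *
     set_fresh (lam_e / lam) n #|S|.
  have L0 : lam != 0 by rewrite gt_eqF.
  have N0 : n%:R != 0 :> R by rewrite pnatr_eq0 -lt0n ltnW.
  by field; rewrite L0 N0.
move=> /= E; move: E; move: (\sum_(i | _) _) => sm.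
move: (set_fresh _ _ #|S|) (set_fresh _ _ _.+1) (pull_rate _ _) => p q c.
move: (some_fresh S x)%:R (#|S|%:R) => f k E.
apply/eqP; rewrite -subr_eq0; apply/eqP.
transitivity (lam * (k / n%:R + c * q) - (lam_e + k * (lam / n%:R) + lam * c) * p).
  by ring.
by rewrite E subrr.
Qed.

Lemma mean_centered_decay (p0 : fstate n -> R) (S : {set 'I_n}) t : 0 <= t ->
  `|mean_of lam_e lam p0 (centered S) t| <=
  (\sum_T `|mean_of lam_e lam p0 (centered T) 0|) * expR (- lam_e * t).
Proof.
(* Summing over all sets gives a single constant valid for every [S], which lets the induction close
   without growth. *)
set D := \sum_T _.
have [m] := ubnP (n - #|S|)%N; elim: m S t => // m IH S t; rewrite ltnS => Sm t0.
pose kap := #|S|%:R * (lam / n.-1%:R).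
have kap0 : 0 <= kap by rewrite !mulr_ge0 ?invr_ge0// ltW.
pose b := lam_e + #|S|%:R * (lam / n%:R) + lam * pull_rate n #|S|.
apply: (@ode_decay _ (fun s => - b * mean_of lam_e lam p0 (centered S) s +
   \sum_(i | i \notin S) kap * mean_of lam_e lam p0 (centered (i |: S)) s) _ b) => //.
- move=> s; apply: (is_derive_eq (is_derive_mean_of _ _ _ _ _)).
  rewrite (eq_mean_of _ _ _ _ (gen_app_centered S)) mean_ofD mean_ofZ mean_of_sum.
  by congr (_ + _); apply: eq_bigr => i _; rewrite mean_ofZ.
- move=> s s0; rewrite mulNr addrAC addNr add0r.
  apply: le_trans (ler_norm_sum _ _ _) _.
  apply: (@le_trans _ _ (\sum_(i | i \notin S) kap * (D * expR (- lam_e * s)))).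
    apply: ler_sum => i iS; rewrite normrM (ger0_norm kap0) ler_wpM2l// IH//.
    have : (#|i |: S| <= n)%N by rewrite -[n in leqRHS]card_ord max_card.
    by move: Sm; rewrite cardsU1 iS; lia.
  (* The off-diagonal weights sum to [lam * pull_rate n #|S|], which is [b] minus [lam_e] and the
     source rate, hence at most [b - lam_e]. *)
  rewrite -mulr_suml sum_pull_rate ler_wpM2r//.
    by rewrite mulr_ge0 ?expR_ge0 ?sumr_ge0.
  have : 0 <= #|S|%:R * (lam / n%:R) by rewrite !mulr_ge0 ?invr_ge0// ltW.
  by rewrite /b; move: (#|S|%:R * (lam / n%:R)) (lam * _) => u v; lra.
- by rewrite /D (bigD1 S)//= lerDl sumr_ge0.
Qed.

Lemma mean_fresh1_cvg (p0 : fstate n -> R) : is_distr p0 ->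
  mean_fresh1 lam_e lam p0 t @[t --> +oo] --> set_fresh (lam_e / lam) n 1.
Proof.
move=> p0P; pose i0 := Ordinal (ltnW n_gt1).
have meanE t : mean_fresh1 lam_e lam p0 t =
    mean_of lam_e lam p0 (centered [set i0]) t + set_fresh (lam_e / lam) n 1.
  (* The equilibrium constant is absorbed into the mean because [p0] has total mass 1; freshness of
     the first node is then [some_fresh] of a singleton. *)
  rewrite -[X in _ + X]mulr1 -(mean_of_const1 lam_e lam t p0P) -mean_ofZ -mean_ofD.
  apply: eq_mean_of => x; rewrite /centered cards1 mulr1 subrK; congr (nat_of_bool _)%:R.
  apply/existsP/existsP => -[i].
    by move=> /andP[/eqP i_0 xi]; exists i; rewrite xi inE andbT -val_eqE /= i_0.
  by rewrite inE => /andP[/eqP-> xi]; exists i0; rewrite xi.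
under eq_fun do rewrite meanE.
rewrite -[X in nbhs X]add0r; apply: cvgD; last exact: cvg_cst.
pose D := \sum_T `|mean_of lam_e lam p0 (centered T) 0|.
have e0 : D * expR (- lam_e * t) @[t --> +oo] --> (0 : R).
  rewrite -(mulr0 D); apply: cvgM; first exact: cvg_cst.
  under eq_fun do rewrite mulNr.
  apply: (@cvg_comp _ _ _ (fun t => lam_e * t) (fun u => expR (- u)) _ +oo); last exact: cvgr_expR.
  by apply: gt0_cvgMry => //; exact: cvg_id.
apply: (@squeeze_cvgr _ _ _ _ (fun t => - (D * expR (- lam_e * t))) _ _ _ _ _ e0).
  near=> t; rewrite -ler_norml; apply: mean_centered_decay.
  by near: t; apply: nbhs_pinfty_ge; rewrite num_real.
by rewrite -oppr0; apply: cvgN.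
Unshelve. all: by end_near. Qed.
End Decay.

Theorem theorem4 (R : realType) (lam_e lam : R) :
  0 < lam_e -> 0 < lam ->
  exists Fn : nat -> R,
    (* Fn n = lim_{t -> oo} E[F_1(t)] (for any initial distribution) *)
    (forall n : nat, (2 <= n)%N ->
       forall p0 : fstate n -> R, is_distr p0 ->
         mean_fresh1 lam_e lam p0 t @[t --> +oo] --> Fn n) /\
    (0 < lam_e / lam < 1 ->
       theta_eventually Fn (fun n => powR (n%:R) (- (lam_e / lam)))) /\
    (lam_e / lam = 1 ->
       theta_eventually Fn (fun n => ln (n%:R) / n%:R)) /\
    (1 < lam_e / lam ->
       theta_eventually Fn (fun n => (n%:R)^-1)).
Proof.
move=> le0 l0; exists (fun n => set_fresh (lam_e / lam) n 1).
split; first by move=> n n2 p0 p0P; exact: mean_fresh1_cvg.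
split; first exact: set_fresh_theta_lt1.
split; last exact: set_fresh_theta_gt1.
by move=> ->; exact: set_fresh_theta_eq1.
Qed.
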